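(* $\mathbf{MIN}(\backslash)=\mathbf{MIL}(\backslash)$: in the language extended with the binary connective $\backslash$, a formula is valid on all posets under the minimal-upper-bound semantics if and only if it is valid on all posets under the supremum semantics.
   Context: The language is given by $\varphi::=\bot\mid p\mid\neg\varphi\mid\varphi\lor\varphi\mid\Diamond\varphi\varphi\mid\varphi\backslash\varphi$. A poset model is $(P,\leq,V)$ with $(P,\leq)$ a partial order and $V$ a valuation. For $s,t,u\in P$: $s\in\mathrm{mub}\{t,u\}$ iff $s$ is an upper bound of $\{t,u\}$ and no upper bound $x$ of $\{t,u\}$ satisfies $x<s$; $s=\sup\{t,u\}$ iff $s$ is an upper bound of $\{t,u\}$ below every upper bound of $\{t,u\}$. Booleans are classical. Minimal-upper-bound semantics: $s\Vdash\Diamond\varphi\psi$ iff there are $t,u$ with $t\Vdash\varphi$, $u\Vdash\psi$, $s\in\mathrm{mub}\{t,u\}$; and $u\Vdash\varphi\backslash\psi$ iff for all $t,s\in P$, if $t\Vdash\varphi$ and $s\in\mathrm{mub}\{t,u\}$ then $s\Vdash\psi$. Supremum semantics: the same clauses with ''$s\in\mathrm{mub}\{t,u\}$'' replaced by ''$s=\sup\{t,u\}$''. $\mathbf{MIN}(\backslash)$ (resp. $\mathbf{MIL}(\backslash)$) is the set of formulas true at every point of every poset model under the minimal-upper-bound (resp. supremum) semantics. *)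

(* Defs.v *)
From Stdlib Require Import Relations.Relation_Definitions.

Set Implicit Arguments.

Inductive formula (Atom : Type) : Type :=
| Bot : formula Atom
| Var : Atom -> formula Atom
| Neg : formula Atom -> formula Atom
| Or : formula Atom -> formula Atom -> formula Atom
| Dia : formula Atom -> formula Atom -> formula Atom
| Back : formula Atom -> formula Atom -> formula Atom.

Arguments Bot {Atom}.

Record poset_model (Atom : Type) : Type := PosetModel {
  point :> Type;
  le : relation point;
  le_order : order point le;
  val : Atom -> point -> Prop
}.

Definition upper_bound (P : Type) (le : relation P) (t u s : P) : Prop :=
  le t s /\ le u s.

Definition is_mub (P : Type) (le : relation P) (t u s : P) : Prop :=
  upper_bound le t u s /\
  ~ (exists x, upper_bound le t u x /\ le x s /\ x <> s).

Definition is_sup (P : Type) (le : relation P) (t u s : P) : Prop :=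
  upper_bound le t u s /\ forall x, upper_bound le t u x -> le s x.

(* The two semantics differ only in [bound], the relation between the pair
   {t, u} and s: [is_mub] for one, [is_sup] for the other.  Note that
   [Back phi psi] (written phi \ psi) is evaluated at the point u. *)
Fixpoint forces (bound : forall P : Type, relation P -> P -> P -> P -> Prop)
    (Atom : Type) (M : poset_model Atom) (w : M) (f : formula Atom) : Prop :=
  match f with
  | Bot => False
  | Var p => val M p w
  | Neg phi => ~ forces bound M w phi
  | Or phi psi => forces bound M w phi \/ forces bound M w psi
  | Dia phi psi =>
      exists t u : M,
        forces bound M t phi /\ forces bound M u psi /\ bound M (le M) t u w
  | Back phi psi =>
      forall t s : M,
        forces bound M t phi -> bound M (le M) t w s -> forces bound M s psi
  end.

Definition MIN (Atom : Type) (phi : formula Atom) : Prop :=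
  forall (M : poset_model Atom) (w : M), forces is_mub M w phi.

Definition MIL (Atom : Type) (phi : formula Atom) : Prop :=
  forall (M : poset_model Atom) (w : M), forces is_sup M w phi.

(* Main.v *)
From Stdlib Require Import Relations.Relation_Definitions Classical.
From Stdlib Require Import FunctionalExtensionality PropExtensionality.
From Stdlib Require Import Eqdep_dec PeanoNat Lia.
Require Import Defs.

Set Implicit Arguments.

(** Both [is_mub] and [is_sup] satisfy [bound_axioms], so it suffices to show
    that any relation B satisfying them, on any set P, is represented by a
    poset Q with a labelling Q -> P such that every minimal upper bound in Q
    yields a B-triple of labels, while every B-triple required by the clauses
    for [Dia] and [Back] is realised in Q by a supremum.  As suprema are
    minimal upper bounds, the labelling then preserves truth under either
    semantics on Q.

    Q is the union of a sequence of posets.  To pass from one to the next,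
    place a fresh maximal point above each x for every label above that of x,
    then two fresh minimal points below each point for every label below.
    This realises all required triples, but creates minimal upper bounds v of
    pairs {a, b} whose labels are not in B.  Each of these is destroyed by an
    infinite descending chain, labelled like v, strictly between {a, b}
    and v. *)

(** * Common properties of minimal upper bounds and suprema *)

Record bound_axioms (P : Type) (B : P -> P -> P -> Prop) : Prop := {
  bound_sym : forall t u s, B t u s -> B u t s;
  bound_left : forall t u s, B t u s -> B t s s;
  bound_refl : forall s, B s s s;
  bound_trans : forall r s t, B r s s -> B s t t -> B r t t
}.

Arguments bound_sym {P B} _ {t u s} _.
Arguments bound_left {P B} _ {t u s} _.
Arguments bound_trans {P B} _ {r s t} _ _.

Lemma is_mub_le (P : Type) (le : relation P) :
  order P le -> forall t s, le t s -> is_mub le t s s.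
Proof.
  intros [Hr Ht Ha] t s H; split; [split; auto|].
  intros [x [[_ H1] [H2 H3]]]; auto.
Qed.

Lemma is_mub_axioms (P : Type) (le : relation P) :
  order P le -> bound_axioms (is_mub le).
Proof.
  intros O; pose proof (is_mub_le O) as L; destruct O as [Hr Ht Ha]; split.
  - intros t u s [[H1 H2] H3]; split; [split; auto|].
    intros [x [[? ?] ?]]; apply H3; exists x; repeat split; tauto.
  - intros t u s [[H1 _] _]; auto.
  - auto.
  - intros r s t [[H1 _] _] [[H2 _] _]; eauto.
Qed.

Lemma is_sup_axioms (P : Type) (le : relation P) :
  order P le -> bound_axioms (is_sup le).
Proof.
  intros [Hr Ht Ha]; split.
  - intros t u s [[H1 H2] H3]; split; [split; auto|].
    intros x [? ?]; apply H3; split; auto.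
  - intros t u s [[H1 _] _]; split; [split; auto|]. intros x [_ ?]; auto.
  - intros s; split; [split; auto|]. intros x [_ ?]; auto.
  - intros r s t [[H1 _] _] [[H2 _] _]; split; [split; eauto|].
    intros x [_ ?]; auto.
Qed.

Lemma is_sup_is_mub (P : Type) (le : relation P) :
  order P le -> forall t u s, is_sup le t u s -> is_mub le t u s.
Proof.
  intros [Hr Ht Ha] t u s [H1 H2]; split; auto.
  intros [x [H3 [H4 H5]]]; auto.
Qed.

(** * Labelled posets *)

Section Representation.

Variables (P : Type) (B : P -> P -> P -> Prop) (HB : bound_axioms B).

(** [B r s s] plays the part of an order on labels: [bound_refl] and [bound_trans] make it a
    preorder, and labels are monotone for it. *)
Record lposet : Type := LPoset {
  car :> Type;
  sle : relation car;
  lab : car -> P;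
  sle_order : order car sle;
  lab_mono : forall x y, sle x y -> B (lab x) (lab y) (lab y)
}.

Arguments sle {l} _ _.
Arguments lab {l} _.

Definition good (X : lposet) : Prop :=
  forall t u s : X, is_mub sle t u s -> B (lab t) (lab u) (lab s).

Lemma sle_refl (X : lposet) (x : X) : sle x x.
Proof. apply (ord_refl _ _ (sle_order X)). Qed.

Lemma sle_trans (X : lposet) (x y z : X) : sle x y -> sle y z -> sle x z.
Proof. apply (ord_trans _ _ (sle_order X)). Qed.

Lemma sle_antisym (X : lposet) (x y : X) : sle x y -> sle y x -> x = y.
Proof. apply (ord_antisym _ _ (sle_order X)). Qed.

Arguments sle_refl {X} x.
Arguments sle_trans {X x y z} _ _.
Arguments sle_antisym {X x y} _ _.

Hint Resolve sle_refl sle_trans sle_antisym lab_mono : core.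

Lemma B_top_l (X : lposet) (x y : X) : sle y x -> B (lab x) (lab y) (lab x).
Proof. intros H; apply (bound_sym HB), lab_mono, H. Qed.

Hint Resolve B_top_l : core.

(** * Adjoining fresh maximal points *)

Section Up.

Variables (X : lposet) (I : Type) (h : I -> X) (l : I -> P).
Hypothesis Hl : forall i, B (lab (h i)) (l i) (l i).

Definition up_le (a b : X + I) : Prop :=
  match a, b with
  | inl x, inl y => sle x y
  | inl x, inr i => sle x (h i)
  | inr i, inr j => i = j
  | inr _, inl _ => False
  end.

Definition up_lab (a : X + I) : P :=
  match a with inl x => lab x | inr i => l i end.

Lemma up_order : order _ up_le.
Proof.
  split.
  - intros [x|i]; simpl; auto.
  - intros [x|i] [y|j] [z|k]; simpl; intros; subst; try tauto; eauto.
  - intros [x|i] [y|j]; simpl; intros; try tauto; f_equal; auto.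
Qed.

Lemma up_mono a b : up_le a b -> B (up_lab a) (up_lab b) (up_lab b).
Proof.
  destruct a as [x|i], b as [y|j]; simpl; intros H; subst; try tauto; auto.
  - apply (bound_trans HB (s := lab (h j))); auto.
  - apply (bound_refl HB).
Qed.

Definition up : lposet := LPoset up_lab up_order up_mono.

(** Two old points below a fresh [inr k] are already bounded by the old [h k] strictly below it. So
    a fresh minimal upper bound must be one of the two points itself, where monotone labels
    suffice. *)
Lemma up_good : good X -> good up.
Proof.
  intros G a b v [[H1 H2] H3].
  destruct v as [v|k].
  - destruct a as [a|i]; [|destruct H1]. destruct b as [b|j]; [|destruct H2].
    apply G; split; [split; auto|].
    intros [x [[E1 E2] [E3 E4]]]; apply H3; exists (inl x).
    repeat split; auto. congruence.
  - destruct a as [a|i]; [destruct b as [b|j]|].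
    + exfalso; apply H3; exists (inl (h k)).
      repeat split; simpl; auto. discriminate.
    + simpl in H2; subst j. apply (up_mono (inl a) (inr k)); auto.
    + simpl in H1; subst i. apply (bound_sym HB).
      apply (up_mono b (inr k)); auto.
Qed.

Lemma up_sup (t u s : X) :
  is_sup sle t u s -> is_sup (@sle up) (inl t) (inl u) (inl s).
Proof.
  intros [[H1 H2] H3]; split; [split; auto|].
  intros [x|i] [E1 E2]; simpl in *; apply H3; split; auto.
Qed.

End Up.

(** * Adjoining fresh minimal points *)

Section Down.

Variables (X : lposet) (I : Type) (h : I -> X) (l : I -> P).
Hypothesis Hl : forall i, B (l i) (lab (h i)) (lab (h i)).

Definition down_le (a b : X + I) : Prop :=
  match a, b with
  | inl x, inl y => sle x y
  | inr i, inl y => sle (h i) y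
  | inr i, inr j => i = j
  | inl _, inr _ => False
  end.

Definition down_lab (a : X + I) : P :=
  match a with inl x => lab x | inr i => l i end.

Lemma down_order : order _ down_le.
Proof.
  split.
  - intros [x|i]; simpl; auto.
  - intros [x|i] [y|j] [z|k]; simpl; intros; subst; try tauto; eauto.
  - intros [x|i] [y|j]; simpl; intros; try tauto; f_equal; auto.
Qed.

Lemma down_mono a b :
  down_le a b -> B (down_lab a) (down_lab b) (down_lab b).
Proof.
  destruct a as [x|i], b as [y|j]; simpl; intros H; subst; try tauto; auto.
  - apply (bound_trans HB (s := lab (h i))); auto.
  - apply (bound_refl HB).
Qed.

Definition down : lposet := LPoset down_lab down_order down_mono.

Lemma down_sup (t u s : X) :
  is_sup sle t u s -> is_sup (@sle down) (inl t) (inl u) (inl s).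
Proof.
  intros [[H1 H2] H3]; split; [split; auto|].
  intros [x|i] [E1 E2]; simpl in *; [apply H3; split; auto|tauto].
Qed.

(** Fresh points are minimal, so none of them bounds an old point. *)
Lemma down_mub_old (a b : X) (v : down) :
  is_mub (@sle down) (inl a) (inl b) v ->
  exists v', v = inl v' /\ is_mub sle a b v'.
Proof.
  intros [[H1 H2] H3]; destruct v as [v|k]; [|destruct H1].
  exists v; split; auto; split; [split; auto|].
  intros [x [[E1 E2] [E3 E4]]]; apply H3; exists (inl x).
  repeat split; auto. congruence.
Qed.

End Down.

(** * Destroying unwanted minimal upper bounds *)

Section Kill.

Variable X : lposet.

Record defect : Type := Defect {
  dl : X; dr : X; dtop : X;
  dmub : is_mub sle dl dr dtop;
  dbad : ~ B (lab dl) (lab dr) (lab dtop)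
}.

Lemma dl_le d : sle (dl d) (dtop d).
Proof. apply (dmub d). Qed.

Lemma dr_le d : sle (dr d) (dtop d).
Proof. apply (dmub d). Qed.

(** Otherwise the top would equal [dl d], and monotone labels would put the triple in [B], against
    [dbad]. *)
Lemma dl_strict d : ~ sle (dtop d) (dl d).
Proof.
  intros H; apply (dbad d).
  pose proof (sle_antisym H (dl_le d)) as E.
  rewrite E; apply (bound_sym HB), lab_mono; rewrite <- E; apply dr_le.
Qed.

Lemma dr_strict d : ~ sle (dtop d) (dr d).
Proof.
  intros H; apply (dbad d).
  pose proof (sle_antisym H (dr_le d)) as E.
  rewrite E; apply lab_mono; rewrite <- E; apply dl_le.
Qed.

Hint Resolve dl_le dr_le : core.

(* [(d, n)] is the [n]-th element of the chain inserted below [dtop d]; chains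
   descend as [n] grows. *)
Definition kill_le (a b : X + defect * nat) : Prop :=
  match a, b with
  | inl x, inl y => sle x y
  | inl x, inr (d, _) => sle x (dl d) \/ sle x (dr d)
  | inr (d, _), inl y => sle (dtop d) y
  | inr (d, n), inr (e, m) =>
      (d = e /\ m <= n) \/ sle (dtop d) (dl e) \/ sle (dtop d) (dr e)
  end.

Definition kill_lab (a : X + defect * nat) : P :=
  match a with inl x => lab x | inr (d, _) => lab (dtop d) end.

Lemma kill_order : order _ kill_le.
Proof.
  split.
  - intros [x|[d n]]; simpl; auto.
  - intros [x|[d n]] [y|[e m]] [z|[g k]]; simpl; intros H1 H2;
      repeat match goal with
      | H : _ \/ _ |- _ => destruct H
      | H : _ /\ _ |- _ => destruct H
      end; subst; eauto 6.
    left; split; [auto | lia].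
  (* A cycle through distinct points would put an old point between some [dtop d] and [dl d] or
     [dr d], against strictness. *)
  - assert (L : forall d x, sle (dtop d) x -> sle x (dl d) -> False)
      by (intros d x ? ?; apply (@dl_strict d); eauto).
    assert (R : forall d x, sle (dtop d) x -> sle x (dr d) -> False)
      by (intros d x ? ?; apply (@dr_strict d); eauto).
    intros [x|[d n]] [y|[e m]]; simpl; intros H1 H2;
      repeat match goal with
      | H : _ \/ _ |- _ => destruct H
      | H : _ /\ _ |- _ => destruct H
      end; subst; try solve [f_equal; auto]; try solve [exfalso; eauto].
    do 2 f_equal; lia.
Qed.

Lemma kill_mono a b :
  kill_le a b -> B (kill_lab a) (kill_lab b) (kill_lab b).
Proof.
  destruct a as [x|[d n]], b as [y|[e m]]; simpl; intros H;
    repeat match goal with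
    | H : _ \/ _ |- _ => destruct H
    | H : _ /\ _ |- _ => destruct H
    end; subst; eauto.
Qed.

Definition kill : lposet := LPoset kill_lab kill_order kill_mono.

(* Least old element above a point. *)
Definition kill_cover (a : kill) : X :=
  match a with inl x => x | inr (d, _) => dtop d end.

Lemma kill_cover_le (a : kill) (y : X) :
  sle a (inl y : kill) <-> sle (kill_cover a) y.
Proof. destruct a as [x|[d n]]; simpl; tauto. Qed.

Lemma kill_cover_lab (a : kill) : lab (kill_cover a) = lab a.
Proof. destruct a as [x|[d n]]; reflexivity. Qed.

Lemma le_kill_cover (a : kill) : sle a (inl (kill_cover a) : kill).
Proof. apply kill_cover_le, sle_refl. Qed.

(** Chains have no least element: if both [a] and [b] differ from [(d, n)], then [(d, S n)] bounds
    them too and lies strictly below. *)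
Lemma kill_mub_chain (a b : kill) d n :
  is_mub sle a b (inr (d, n) : kill) ->
  a = inr (d, n) \/ b = inr (d, n).
Proof.
  intros [[H1 H2] H3].
  destruct (classic (a = inr (d, n))) as [|Na]; auto.
  destruct (classic (b = inr (d, n))) as [|Nb]; auto.
  assert (K : forall c : kill, sle c (inr (d, n) : kill) ->
            c <> inr (d, n) -> sle c (inr (d, S n) : kill)).
  { intros [x|[e m]]; simpl; auto. intros [[-> Hm]|Hm] N; auto.
    left; split; auto. assert (m <> n) by congruence. lia. }
  exfalso; apply H3; exists (inr (d, S n)). split; [split; auto|].
  split; [left; auto|]. intros E; injection E; lia.
Qed.

(** For chain points, use [kill_mub_chain]. An old one is also a minimal upper bound of the covers,
    which carry the same labels; a triple outside [B] would make a defect, whose chain supplies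
    smaller upper bounds. *)
Lemma kill_good : good kill.
Proof.
  intros a b [m|[d n]] H.
  - rewrite <- (kill_cover_lab a), <- (kill_cover_lab b).
    apply NNPP; intros N. destruct H as [[H1 H2] H3].
    assert (M : is_mub sle (kill_cover a) (kill_cover b) m).
    { split; [split; apply kill_cover_le; auto|].
      intros [x [[E1 E2] [E3 E4]]]; apply H3; exists (inl x).
      repeat split; try apply kill_cover_le; auto. congruence. }
    apply H3; exists (inr (Defect M N, 0)).
    split; [split|split; [exact (sle_refl m) | discriminate]].
    + eapply sle_trans; [apply le_kill_cover|]. simpl; auto.
    + eapply sle_trans; [apply le_kill_cover|]. simpl; auto.
  - destruct (kill_mub_chain H) as [E|E]; destruct H as [[H1 H2] _]; subst.
    + apply (bound_sym HB). exact (kill_mono _ _ H2).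
    + exact (kill_mono _ _ H1).
Qed.

(** Only a chain point can spoil the supremum, by bounding [t] and [u] but not [s]. If [t] and [u]
    lie below the same one of [dl d] and [dr d], so does [s]; the two hypotheses cover the mixed
    cases. *)
Lemma kill_sup (t u s : X) :
  is_sup sle t u s ->
  (forall d, sle t (dl d) -> sle u (dr d) -> sle s (dl d) \/ sle s (dr d)) ->
  (forall d, sle u (dl d) -> sle t (dr d) -> sle s (dl d) \/ sle s (dr d)) ->
  is_sup (@sle kill) (inl t) (inl u) (inl s).
Proof.
  intros [[H1 H2] H3] D1 D2; split; [split; auto|].
  intros [x|[d n]]; intros [E1 E2]; simpl in *; [apply H3; split; auto|].
  destruct E1, E2; auto.
  - left; apply H3; split; auto.
  - right; apply H3; split; auto.
Qed.

End Kill.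

(** * One step of the construction *)

Definition raise (X : lposet) : lposet :=
  @up X {q : X * P | B (lab (fst q)) (snd q) (snd q)}
    (fun i => fst (proj1_sig i)) (fun i => snd (proj1_sig i))
    (fun i => proj2_sig i).

(* The boolean provides two distinct copies, so that a point can be the
   supremum of two fresh points carrying the same label. *)
Definition lower (X : lposet) : lposet :=
  @down X {q : X * P * bool |
            B (snd (fst q)) (lab (fst (fst q))) (lab (fst (fst q)))}
    (fun i => fst (fst (proj1_sig i))) (fun i => snd (fst (proj1_sig i)))
    (fun i => proj2_sig i).

Definition step (X : lposet) : lposet := kill (lower (raise X)).

Definition embed (X : lposet) (x : X) : step X := inl (inl (inl x)).

Arguments embed {X} x.

(** If [dl d] and [dr d] lie above points of [X], both belong to [raise X], which is good by
    [up_good]. So no such defect exists, and the side conditions of [kill_sup] hold vacuously. *)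
Lemma step_sup (X : lposet) (t u s : X) :
  good X -> is_sup sle t u s -> is_sup sle (embed t) (embed u) (embed s).
Proof.
  intros G H.
  assert (K : forall (x y : X) (d : defect (lower (raise X))),
    sle (inl (inl x) : lower (raise X)) (dl d) ->
    sle (inl (inl y) : lower (raise X)) (dr d) -> False).
  { intros x y [a b v M N] H1 H2; simpl in H1, H2.
    destruct a as [a|i]; [|destruct H1]. destruct b as [b|j]; [|destruct H2].
    destruct (down_mub_old M) as [v' [-> M']].
    apply N. exact (up_good G M'). }
  apply kill_sup.
  - apply down_sup, up_sup, H.
  - intros d H1 H2; destruct (K _ _ _ H1 H2).
  - intros d H1 H2; destruct (K _ _ _ H1 H2).
Qed.

(** [t'] and [u'] are fresh minimal points below [s]; before chains are added, everything else above
    either of them is above [s]. A defect separating them from [s] would have them as its pair and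
    [s] as its top, but that triple is in [B]. *)
Lemma step_dia (X : lposet) (s : X) (t u : P) :
  B t u (lab s) ->
  exists t' u' : step X,
    lab t' = t /\ lab u' = u /\ is_sup sle t' u' (embed s).
Proof.
  intros H.
  pose (i := exist (fun q : raise X * P * bool =>
     B (snd (fst q)) (lab (fst (fst q))) (lab (fst (fst q))))
     (inl s, t, false) (bound_left HB H)).
  pose (j := exist (fun q : raise X * P * bool =>
     B (snd (fst q)) (lab (fst (fst q))) (lab (fst (fst q))))
     (inl s, u, true) (bound_left HB (bound_sym HB H))).
  assert (Nij : i <> j) by (intros E; apply (f_equal (@proj1_sig _ _)) in E; discriminate).
  pose (s0 := inl (inl s) : lower (raise X)).
  assert (S : is_sup (@sle (lower (raise X))) (inr i) (inr j) s0).
  { split; [split; exact (sle_refl (inl s : raise X))|].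
    intros [x|k] [E1 E2]; simpl in *; [exact E1|congruence]. }
  exists (inl (inr i)), (inl (inr j)).
  split; [reflexivity|]. split; [reflexivity|].
  assert (K : forall d : defect (lower (raise X)), forall a b,
    ((a = i /\ b = j) \/ (a = j /\ b = i)) ->
    sle (inr a : lower (raise X)) (dl d) ->
    sle (inr b : lower (raise X)) (dr d) -> sle s0 (dl d) \/ sle s0 (dr d)).
  { intros [a b v M N] k l Hkl H1 H2; simpl in H1, H2 |- *.
    destruct a as [a|a].
    { left; destruct Hkl as [[-> ->]|[-> ->]]; exact H1. }
    destruct b as [b|b].
    { right; destruct Hkl as [[-> ->]|[-> ->]]; exact H2. }
    exfalso; simpl in H1, H2; subst a b.
    assert (v = s0) as ->.
    { apply NNPP; intros Nv. destruct M as [M1 M2]. apply M2. exists s0.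
      destruct Hkl as [[-> ->]|[-> ->]];
        (split; [split; apply S | split; [apply S; split; apply M1 | auto]]). }
    apply N; destruct Hkl as [[-> ->]|[-> ->]]; [exact H|].
    exact (bound_sym HB H). }
  apply (kill_sup S).
  - intros d H1 H2. apply (K d i j); auto.
  - intros d H1 H2. apply (K d j i); auto.
Qed.

(** [s'] is a fresh maximal point above [u], and [t'] a fresh minimal point below [s']; before
    chains are added, [s'] is the only other point above [t']. A defect separating them from [s']
    would have pair [t'], [u] and top [s'], but that triple is in [B]. *)
Lemma step_back (X : lposet) (u : X) (t s : P) :
  B t (lab u) s ->
  exists t' s' : step X,
    lab t' = t /\ lab s' = s /\ is_sup sle t' (embed u) s'.
Proof.
  intros H.
  pose (m := inr (exist (fun q : X * P => B (lab (fst q)) (snd q) (snd q))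
     (u, s) (bound_left HB (bound_sym HB H))) : raise X).
  pose (i := exist (fun q : raise X * P * bool =>
     B (snd (fst q)) (lab (fst (fst q))) (lab (fst (fst q))))
     (m, t, false) (bound_left HB H)).
  pose (Y := lower (raise X)).
  assert (Top : forall y, sle (inl m : Y) y -> y = inl m).
  { intros [[y|y]|y]; simpl; try tauto. intros <-; reflexivity. }
  assert (Um : sle (inl (inl u) : Y) (inl m)) by exact (sle_refl u).
  assert (Mid : forall b : Y, sle (inl (inl u) : Y) b -> sle b (inl m : Y) ->
            b = inl (inl u) \/ b = inl m).
  { intros [[b|b]|b]; simpl; try tauto; intros H1 H2.
    - left; do 2 f_equal; auto.
    - right; subst; reflexivity. }
  assert (S : is_sup (@sle Y) (inr i) (inl (inl u)) (inl m)).
  { split; [split; [exact (sle_refl m) | exact Um]|].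
    intros [x|k] [E1 E2]; [exact E1|destruct E2]. }
  exists (inl (inr i)), (inl (inl m)). split; [reflexivity|].
  split; [reflexivity|].
  assert (K : forall a b v : Y, is_mub sle a b v ->
    ~ B (lab a) (lab b) (lab v) -> sle (inr i : Y) a ->
    sle (inl (inl u) : Y) b -> sle (inl m : Y) a \/ sle (inl m : Y) b).
  { intros [a|a] b v M N H1 H2; [left; exact H1|].
    simpl in H1; subst a.
    destruct v as [v|v]; [|destruct b; [destruct (proj2 (proj1 M))|destruct H2]].
    assert (Hv : inl v = inl m :> Y) by (apply Top; exact (proj1 (proj1 M))).
    rewrite Hv in *.
    destruct (Mid b H2 (proj2 (proj1 M))) as [->| ->].
    - destruct N; exact H.
    - right; apply sle_refl. }
  apply (kill_sup S).
  - intros [a b v M N]; exact (K a b v M N).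
  - intros [a b v M N] H1 H2; apply or_comm.
    apply (K b a v (bound_sym (is_mub_axioms (sle_order Y)) M)); auto.
    intros E; apply N, (bound_sym HB), E.
Qed.

(** * The sequence of stages and its direct limit *)

Variable w : P.

Definition root : lposet :=
  @LPoset unit (fun _ _ => True) (fun _ => w)
    ltac:(split; [intros []|intros [] [] []|intros [] []]; auto)
    (fun _ _ _ => bound_refl HB w).

Fixpoint chain (n : nat) : lposet :=
  match n with 0 => root | S n => step (chain n) end.

(** Every stage after the root ends with [kill], which yields a good poset from any input. *)
Lemma chain_good n : good (chain n).
Proof.
  destruct n; [intros ? ? ? _; apply (bound_refl HB) | apply kill_good].
Qed.

Definition stage : Type := {n : nat & chain n}.

Definition at_stage (n : nat) (x : chain n) : stage :=
  existT (fun n => car (chain n)) n x.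

Arguments at_stage {n} x.

Definition next (a : stage) : stage := @at_stage (S (projT1 a)) (embed (projT2 a)).

(** An inductive family compares points of one stage without transport along equalities of stage
    numbers. *)
Inductive same_le : stage -> stage -> Prop :=
| same_le_intro n (x y : chain n) : sle x y -> same_le (at_stage x) (at_stage y).

Lemma same_le_inv n (x y : chain n) :
  same_le (at_stage x) (at_stage y) -> sle x y.
Proof.
  intros H.
  assert (K : forall a b, same_le a b -> forall n (x y : chain n),
            a = at_stage x -> b = at_stage y -> sle x y).
  { clear. intros a b [n x y H] m x' y' E1 E2.
    assert (n = m) as -> by exact (f_equal (@projT1 _ _) E1).
    apply (inj_pair2_eq_dec _ Nat.eq_dec) in E1, E2. subst; auto. }
  eauto.
Qed.

Lemma same_le_trans a b c : same_le a b -> same_le b c -> same_le a c.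
Proof.
  intros H; revert c; destruct H as [n x y H]; intros [m z] H2.
  assert (n = m) as ->.
  { change (projT1 (at_stage y) = projT1 (existT (fun n => car (chain n)) m z)).
    destruct H2; reflexivity. }
  apply (@same_le_inv m y z) in H2. apply (@same_le_intro m x z). eauto.
Qed.

Lemma same_le_next a b : same_le (next a) (next b) <-> same_le a b.
Proof.
  destruct a as [n x], b as [m y]; split; intros H.
  - assert (n = m) as ->.
    { cut (S n = S m); [congruence|].
      change (projT1 (next (existT (fun n => car (chain n)) n x)) =
              projT1 (next (existT (fun n => car (chain n)) m y))).
      destruct H; reflexivity. }
    apply (@same_le_intro m x y). exact (same_le_inv (n := S m) H).
  - destruct H as [k x' y' H]. apply (@same_le_intro (S k)). exact H.
Qed.

Lemma same_le_iter k a b :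
  same_le (Nat.iter k next a) (Nat.iter k next b) <-> same_le a b.
Proof.
  induction k; simpl; [tauto|]. rewrite same_le_next; auto.
Qed.

(** Order of the direct limit: compare after pushing both points forward to a common stage. *)
Definition lim_le (a b : stage) : Prop :=
  exists i j, same_le (Nat.iter i next a) (Nat.iter j next b).

Lemma lim_le_refl a : lim_le a a.
Proof. exists 0, 0. destruct a as [n x]. apply same_le_intro, sle_refl. Qed.

Lemma lim_le_trans a b c : lim_le a b -> lim_le b c -> lim_le a c.
Proof.
  (* The images of [b] after [j] and [j'] steps are brought together after [j + j'] steps. *)
  intros [i [j H1]] [j' [k H2]]. exists (j' + i), (j + k).
  apply (same_le_iter j') in H1. apply (same_le_iter j) in H2.
  rewrite <- !Nat.iter_add in H1, H2. rewrite (Nat.add_comm j j') in H2.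
  exact (same_le_trans H1 H2).
Qed.

Lemma iter_next_index k a : projT1 (Nat.iter k next a) = k + projT1 a.
Proof. induction k; simpl; congruence. Qed.

Lemma lim_le_at_stage n (x y : chain n) :
  lim_le (at_stage x) (at_stage y) <-> sle x y.
Proof.
  split.
  - intros [i [j H]].
    assert (i = j) as ->.
    { assert (E : forall a b, same_le a b -> projT1 a = projT1 b)
        by (intros a b []; reflexivity).
      apply E in H. rewrite !iter_next_index in H. simpl in H. lia. }
    apply same_le_iter in H. apply same_le_inv, H.
  - intros H. exists 0, 0. apply (same_le_intro n x y H).
Qed.

Fixpoint lift (k n : nat) (x : chain n) : chain (k + n) :=
  match k with 0 => x | S k => embed (lift k n x) end.

Lemma lift_iter k n (x : chain n) :
  at_stage (lift k n x) = Nat.iter k next (at_stage x).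
Proof. induction k; simpl; [auto|]. rewrite <- IHk. reflexivity. Qed.

Lemma lift_lab k n (x : chain n) : lab (lift k n x) = lab x.
Proof. induction k; simpl; auto. Qed.

Lemma lift_sup k n (t u s : chain n) :
  is_sup sle t u s -> is_sup sle (lift k n t) (lift k n u) (lift k n s).
Proof.
  intros H; induction k; simpl; auto. apply step_sup; auto. apply chain_good.
Qed.

(* Points of the limit are principal downsets, so that stages identified by
   [lim_le] become equal. *)
Definition limit : Type :=
  {D : stage -> Prop | exists a, D = fun b => lim_le b a}.

Definition pt (n : nat) (x : chain n) : limit :=
  exist _ (fun b => lim_le b (at_stage x)) (ex_intro _ (at_stage x) eq_refl).

Arguments pt {n} x.

Definition limit_le (p q : limit) : Prop :=
  forall a, proj1_sig p a -> proj1_sig q a.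

Lemma limit_eq (p q : limit) : proj1_sig p = proj1_sig q -> p = q.
Proof.
  destruct p as [D HD], q as [E HE]; simpl; intros <-.
  f_equal; apply proof_irrelevance.
Qed.

Lemma limit_order : order _ limit_le.
Proof.
  split; unfold limit_le; intros p; auto.
  intros q H1 H2; apply limit_eq, functional_extensionality; intros a.
  apply propositional_extensionality; split; auto.
Qed.

Lemma pt_le n (x y : chain n) : limit_le (pt x) (pt y) <-> sle x y.
Proof.
  rewrite <- lim_le_at_stage; unfold limit_le; simpl; split; intros H.
  - apply H, lim_le_refl.
  - intros a Ha; exact (lim_le_trans Ha H).
Qed.

Lemma pt_inj n (x y : chain n) : pt x = pt y -> x = y.
Proof.
  intros E; apply sle_antisym; apply pt_le; rewrite E; intros a; auto.
Qed.

Lemma pt_lift k n (x : chain n) : pt (lift k n x) = pt x.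
Proof.
  assert (E : same_le (at_stage (lift k n x)) (at_stage (lift k n x)))
    by apply same_le_intro, sle_refl.
  apply limit_eq, functional_extensionality; intros b; simpl.
  apply propositional_extensionality; split; intros H.
  - apply (lim_le_trans H). exists 0, k. simpl. rewrite <- lift_iter; exact E.
  - apply (lim_le_trans H). exists k, 0. simpl. rewrite <- lift_iter; exact E.
Qed.

(** Having representatives at all later stages lets finitely many limit points be taken in one
    stage. *)
Lemma pt_surj (p : limit) :
  exists n, forall m, n <= m -> exists x : chain m, p = pt x.
Proof.
  destruct p as [D [[n x] ->]]. exists n. intros m Hm.
  replace m with (m - n + n) by lia. exists (lift (m - n) n x).
  rewrite pt_lift. apply limit_eq; reflexivity.
Qed.

(** A competing upper bound lives at some later stage, and lifting to that stage keeps the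
    supremum. *)
Lemma pt_sup n (t u s : chain n) :
  is_sup sle t u s -> is_sup limit_le (pt t) (pt u) (pt s).
Proof.
  intros H; split; [split; apply pt_le, H|].
  intros q. destruct (pt_surj q) as [m Hm].
  destruct (Hm (m + n)) as [x ->]; [lia|].
  apply (lift_sup m) in H. rewrite <- (pt_lift m n t), <- (pt_lift m n u), <- (pt_lift m n s).
  intros [H1 H2]. apply pt_le. apply H. split; apply pt_le; auto.
Qed.

Lemma pt_mub n (t u s : chain n) :
  is_mub limit_le (pt t) (pt u) (pt s) -> is_mub sle t u s.
Proof.
  intros [[H1 H2] H3]; split; [split; apply pt_le; auto|].
  intros [x [[E1 E2] [E3 E4]]]; apply H3; exists (pt x).
  repeat split; try apply pt_le; auto. intros E; apply E4, pt_inj, E.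
Qed.

(** * Labels of limit points *)

Definition labels (p : limit) (c : P) : Prop :=
  exists n (x : chain n), p = pt x /\ lab x = c.

Lemma labels_total p : exists c, labels p c.
Proof.
  destruct (pt_surj p) as [n H]. destruct (H n) as [x E]; auto.
  exists (lab x), n, x; auto.
Qed.

Lemma labels_stage p c :
  labels p c -> exists n, forall m, n <= m ->
    exists x : chain m, p = pt x /\ lab x = c.
Proof.
  intros [n [x [-> <-]]]. exists n. intros m Hm.
  replace m with (m - n + n) by lia. exists (lift (m - n) n x).
  rewrite pt_lift, lift_lab; auto.
Qed.

(** At a common stage the triple is still a minimal upper bound, as a smaller bound there would
    persist in the limit; that stage is good. *)
Lemma labels_mub p q r a b c :
  labels p a -> labels q b -> labels r c -> is_mub limit_le p q r -> B a b c.
Proof.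
  intros Hp Hq Hr H.
  destruct (labels_stage Hp) as [n1 K1], (labels_stage Hq) as [n2 K2],
    (labels_stage Hr) as [n3 K3].
  destruct (K1 (n1 + n2 + n3)) as [x [-> <-]]; [lia|].
  destruct (K2 (n1 + n2 + n3)) as [y [-> <-]]; [lia|].
  destruct (K3 (n1 + n2 + n3)) as [z [-> <-]]; [lia|].
  apply chain_good, pt_mub, H.
Qed.

Lemma labels_fun p a b : labels p a -> labels p b -> a = b.
Proof.
  intros Ha Hb.
  destruct (labels_stage Ha) as [n1 K1], (labels_stage Hb) as [n2 K2].
  destruct (K1 (n1 + n2)) as [x [-> <-]]; [lia|].
  destruct (K2 (n1 + n2)) as [y [E <-]]; [lia|].
  apply pt_inj in E; congruence.
Qed.

Lemma labels_dia p a b c :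
  labels p c -> B a b c ->
  exists q r, labels q a /\ labels r b /\ is_sup limit_le q r p.
Proof.
  intros [n [x [-> <-]]] H.
  destruct (step_dia _ x H) as [t [u [E1 [E2 E3]]]].
  exists (@pt (S n) t), (@pt (S n) u).
  split; [exists (S n), t; auto|]. split; [exists (S n), u; auto|].
  (* [embed x] is [lift 1 n x], hence the same limit point as [x]. *)
  rewrite <- (pt_lift 1 n x). apply (@pt_sup (S n)), E3.
Qed.

Lemma labels_back p a b c :
  labels p b -> B a b c ->
  exists q r, labels q a /\ labels r c /\ is_sup limit_le q p r.
Proof.
  intros [n [x [-> <-]]] H.
  destruct (step_back _ x H) as [t [s [E1 [E2 E3]]]].
  exists (@pt (S n) t), (@pt (S n) s).
  split; [exists (S n), t; auto|]. split; [exists (S n), s; auto|].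
  rewrite <- (pt_lift 1 n x). apply (@pt_sup (S n)), E3.
Qed.

End Representation.

(** * Preservation of truth *)

(** [bound'] lies between suprema and minimal upper bounds: where a bound in the limit must be
    produced, a supremum is supplied; where one is given, it is used as a minimal upper bound. *)
Lemma forces_limit (Atom : Type) (M : poset_model Atom)
    (bound bound' : forall P : Type, relation P -> P -> P -> P -> Prop) (w : M) :
  bound_axioms (bound M (le M)) ->
  (forall (P : Type) (le : relation P), order P le ->
     forall t u s, is_sup le t u s -> bound' P le t u s) ->
  (forall (P : Type) (le : relation P), order P le ->
     forall t u s, bound' P le t u s -> is_mub le t u s) ->
  exists (M' : poset_model Atom) (w' : M'),
    forall f, forces bound' M' w' f <-> forces bound M w f.
Proof.
  intros HB Hsup Hmub.
  pose (L := @labels _ _ HB w).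
  pose (O := @limit_order _ _ HB w).
  pose (M' := PosetModel O (fun (p : Atom) q => exists c, L q c /\ val M p c)).
  assert (K : forall f (q : M') (c : M), L q c ->
            (forces bound' M' q f <-> forces bound M c f)).
  { induction f as [|p|f IH|f IHf g IHg|f IHf g IHg|f IHf g IHg];
      intros q c Hq; simpl.
    - tauto.
    - split; [intros [d [Hd V]]|eauto].
      rewrite (labels_fun Hq Hd); exact V.
    - rewrite (IH q c Hq); tauto.
    - rewrite (IHf q c Hq), (IHg q c Hq); tauto.
    - split.
      + intros [t [u [H1 [H2 H3]]]].
        destruct (labels_total t) as [a Ha], (labels_total u) as [b Hb].
        exists a, b. split; [apply (IHf t a Ha), H1|].
        split; [apply (IHg u b Hb), H2|].
        exact (labels_mub Ha Hb Hq (Hmub _ _ O _ _ _ H3)).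
      + intros [a [b [H1 [H2 H3]]]].
        destruct (labels_dia a b Hq H3) as [t [u [Ha [Hb H4]]]].
        exists t, u. split; [apply (IHf t a Ha), H1|].
        split; [apply (IHg u b Hb), H2|]. apply Hsup; auto.
    - split.
      + intros H a b H1 H2.
        destruct (labels_back a b Hq H2) as [t [s [Ha [Hb H4]]]].
        apply (IHg s b Hb), (H t s); [apply (IHf t a Ha), H1|].
        apply Hsup; auto.
      + intros H t s H1 H2.
        destruct (labels_total t) as [a Ha], (labels_total s) as [b Hb].
        apply (IHg s b Hb), (H a b); [apply (IHf t a Ha), H1|].
        exact (labels_mub Ha Hq Hb (Hmub _ _ O _ _ _ H2)). }
  exists M', (@pt _ _ HB w 0 tt). intros f; apply K.
  exists 0, tt; auto.
Qed.

Theorem theorem5 (Atom : Type) (phi : formula Atom) : MIN phi <-> MIL phi.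
Proof.
  split; intros H M w.
  (* A model under suprema is represented by a limit model under minimal upper bounds, where [phi]
     is valid; the converse exchanges the roles. *)
  - destruct (@forces_limit Atom M is_sup is_mub w) as [M' [w' K]].
    + apply is_sup_axioms, le_order.
    + exact is_sup_is_mub.
    + auto.
    + apply K, H.
  - destruct (@forces_limit Atom M is_mub is_sup w) as [M' [w' K]].
    + apply is_mub_axioms, le_order.
    + auto.
    + exact is_sup_is_mub.
    + apply K, H.
Qed.
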